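(* Let $\Omega\subseteq\mathbb{R}^2$ be a domain and let $u\in C^\infty(\Omega)$ with $|Du|<1$ on $\Omega$, so that its graph $\Sigma_u$ is a spacelike graph in $\mathbb{L}^3$. Suppose that $H_R=H_L$ on $\Omega$, and let $\Omega^\ast=\{(x_1,x_2)\in\Omega: Du(x_1,x_2)\neq 0\}$. Then $$\mathrm{width}(\Omega^\ast)\le \frac{1}{\sqrt2\,\inf_{\Omega^\ast}|H_L|}.$$
   Context: A domain is a connected open set. $\mathbb{L}^3$ is $\mathbb{R}^3$ endowed with the metric $dx_1^2+dx_2^2-dx_3^2$. For $u\in C^\infty(\Omega)$, $\Sigma_u=\{(x_1,x_2,u(x_1,x_2)):(x_1,x_2)\in\Omega\}$; it is spacelike if and only if $|Du|<1$, where $D$ and $|\cdot|$ are the Euclidean gradient and norm in $\mathbb{R}^2$. The mean curvature functions of a spacelike graph $\Sigma_u$ with respect to the metrics induced by $\mathbb{L}^3$ and by the Euclidean space $\mathbb{R}^3$, regarded as functions on $\Omega$, are $H_L=\frac12\mathrm{div}\big(Du/\sqrt{1-|Du|^2}\big)$ and $H_R=\frac12\mathrm{div}\big(Du/\sqrt{1+|Du|^2}\big)$, respectively. The width of a subset of $\mathbb{R}^2$ is the supremum (in $[0,\infty]$) of the diameters of the closed discs contained in it. If $\inf_{\Omega^\ast}|H_L|=0$, the right-hand side is understood as $+\infty$ (nothing is asserted); if $\Omega^\ast=\emptyset$, the inequality is understood to hold trivially. *)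

(* Defs.v *)
From Stdlib Require Import Reals.
From Coquelicot Require Import Coquelicot.
Open Scope R_scope.

(* Stdlib's real numbers with Coquelicot.  A function on an open set Omega of
   R^2 is represented by a total function u : R -> R -> R; the derivatives
   below at a point of Omega depend only on u near that point, so the values
   of u outside Omega never matter. *)

Definition connected (A : R * R -> Prop) : Prop :=
  forall U V : R * R -> Prop,
    open U -> open V ->
    (forall p, A p -> U p \/ V p) ->
    (exists p, A p /\ U p) ->
    (exists p, A p /\ V p) ->
    exists p, A p /\ U p /\ V p.

Definition is_domain (Omega : R * R -> Prop) : Prop :=
  open Omega /\ connected Omega.

(* [ex_diff_n u n x y]: all iterated partial derivatives of u of order at most
   n exist at (x, y) and are continuous there as functions of two variables. *)
Definition smooth_on (Omega : R * R -> Prop) (u : R -> R -> R) : Prop :=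
  forall (n : nat) (x y : R), Omega (x, y) -> ex_diff_n u n x y.

Definition D1 (f : R -> R -> R) (x y : R) : R := Derive (fun s => f s y) x.
Definition D2 (f : R -> R -> R) (x y : R) : R := Derive (fun t => f x t) y.

Definition grad (u : R -> R -> R) (x y : R) : R * R := (D1 u x y, D2 u x y).

Definition div (X : R -> R -> R * R) (x y : R) : R :=
  D1 (fun s t => fst (X s t)) x y + D2 (fun s t => snd (X s t)) x y.

Definition enorm (v : R * R) : R := sqrt (fst v ^ 2 + snd v ^ 2).

Definition vdiv (v : R * R) (c : R) : R * R := (fst v / c, snd v / c).

Definition H_L (u : R -> R -> R) (x y : R) : R :=
  / 2 * div (fun s t => vdiv (grad u s t) (sqrt (1 - enorm (grad u s t) ^ 2))) x y.

Definition H_R (u : R -> R -> R) (x y : R) : R :=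
  / 2 * div (fun s t => vdiv (grad u s t) (sqrt (1 + enorm (grad u s t) ^ 2))) x y.

Definition noncritical (Omega : R * R -> Prop) (u : R -> R -> R) : R * R -> Prop :=
  fun p => Omega p /\ grad u (fst p) (snd p) <> (0, 0).

Definition closed_disc (c : R * R) (r : R) : R * R -> Prop :=
  fun p => enorm (fst p - fst c, snd p - snd c) <= r.

(* The value 0 is added because the supremum is taken in [0, +oo]: a set that
   contains no disc has width 0, not -oo. *)
Definition width (A : R * R -> Prop) : Rbar :=
  Lub_Rbar (fun d => d = 0 \/
    exists (c : R * R) (r : R),
      0 < r /\ (forall p, closed_disc c r p -> A p) /\ d = 2 * r).

Definition inf_abs_on (A : R * R -> Prop) (f : R -> R -> R) : Rbar :=
  Glb_Rbar (fun h => exists x y : R, A (x, y) /\ h = Rabs (f x y)).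

(* Reciprocal on [0, +oo] with 1/0 = +oo and 1/(+oo) = 0; Coquelicot's
   [Rbar_inv] sends 0 to a finite value. *)
Definition recip (x : Rbar) : Rbar :=
  match x with
  | Finite r => if Req_EM_T r 0 then p_infty else Finite (/ r)
  | _ => Finite 0
  end.

(* Main.v *)
Require Import Defs.
From Stdlib Require Import Reals Lra Psatz.
From Coquelicot Require Import Coquelicot.
Open Scope R_scope.

(** Write [v = |Du|], [H = H_L = H_R] and let [kappa] be the curvature of the
    level curves of [u], that is [kappa = div (Du / v)].  In terms of the second
    derivatives, [v ^ 3 * kappa] is the quadratic form
    [F = u_xx u_y^2 - 2 u_xy u_x u_y + u_yy u_x^2].

    The argument has two parts.

    Pointwise, the two expressions for [H] are two linear equations for the
    Laplacian and for [D^2u (Du, Du)], so they determine [kappa]: with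
    [w = sqrt (1 - v^2)] and [W = sqrt (1 + v^2)] one finds
    [v * kappa * (w + W) = 2 * H * (2 + w * W)].  Since
    [(w + W)^2 = 2 (1 + w W)] and [(2 + w W)^2 >= 4 (1 + w W)], and since
    [v < 1], this gives [|kappa| >= 2 sqrt 2 |H|]
    ([level_curvature_algebra], [level_curvature_bound]).

    Globally, let [|H| >= h > 0] at all noncritical points and let a closed disc
    of radius [r] consist of such points.  Then [F] has no zero on the bounding
    circle, hence has a constant sign there.  If [F > 0], take a maximum of [u]
    along the circle, and if [F < 0] a minimum.  There [Du] is normal to the
    circle, the level curve is tangent to it, and, because of this choice of
    the extremum, the second-order condition bounds the absolute value of its
    curvature: [|kappa| <= 1 / r].  Therefore [2 sqrt 2 h <= 1 / r]
    ([curvature_radius_bound]), which is the bound [2 r <= 1 / (sqrt 2 h)] on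
    the diameter.  Integrating [div (Du / v)] over the disc instead would only
    give twice this bound. *)

(** * Functions of one variable *)

Lemma second_derivative_nonpos_at_local_max (f f' : R -> R) (x0 d l : R) :
  0 < d ->
  (forall x, is_derive f x (f' x)) ->
  is_derive f' x0 l ->
  (forall x, Rabs (x - x0) < d -> f x <= f x0) ->
  f' x0 = 0 /\ l <= 0.
Proof.
intros Hd Hf Hf' Hmax.
assert (H0 : f' x0 = 0).
{ assert (Hx0 := proj1 (is_derive_Reals _ _ _) (Hf x0)).
  rewrite <- (derive_pt_eq_0 _ _ _ (exist _ _ Hx0) Hx0).
  apply deriv_maximum with (x0 - d) (x0 + d); try lra.
  intros x H1 H2; apply Hmax; apply Rabs_def1; lra. }
split; [exact H0|].
destruct (Rle_or_lt l 0) as [Hl|Hl]; [exact Hl|exfalso].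
apply is_derive_Reals in Hf'.
destruct (Hf' (l / 2)) as [del Hdel]; [lra|].
(* a positive slope of f' at its zero x0 makes f' > 0, so f increasing, just
   to the right of x0 *)
assert (Hpos : forall x, x0 < x < x0 + del -> 0 < f' x).
{ intros x Hx.
  specialize (Hdel (x - x0)).
  replace (x0 + (x - x0)) with x in Hdel by ring.
  rewrite H0, Rminus_0_r in Hdel.
  assert (H : Rabs (f' x / (x - x0) - l) < l / 2).
  { apply Hdel; [lra|apply Rabs_def1; lra]. }
  apply Rabs_def2 in H.
  replace (f' x) with (f' x / (x - x0) * (x - x0)) by (field; lra).
  apply Rmult_lt_0_compat; lra. }
pose (e := Rmin d del / 2).
assert (He : 0 < e < d /\ e < del).
{ assert (0 < del) by apply cond_pos.
  unfold e; generalize (Rmin_l d del) (Rmin_r d del) (Rmin_pos d del Hd H); lra. }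
destruct (MVT_cor2 f f' x0 (x0 + e)) as [c [Heq Hc]]; [lra| |].
{ intros; apply is_derive_Reals, Hf. }
assert (Hle : f (x0 + e) <= f x0) by (apply Hmax, Rabs_def1; lra).
assert (0 < f' c) by (apply Hpos; lra).
nra.
Qed.

(** Periodicity turns an end-point maximum over one period into a two-sided
    local one. *)
Lemma periodic_max_second_order (f f' f'' : R -> R) (T : R) :
  0 < T ->
  (forall x, f (x + T) = f x) ->
  (forall x, is_derive f x (f' x)) ->
  (forall x, is_derive f' x (f'' x)) ->
  exists x, f' x = 0 /\ f'' x <= 0.
Proof.
intros HT Hper Hf Hf'.
destruct (continuity_ab_maj f 0 T) as [x0 [Hmax Hx0]]; [lra| |].
- intros x _; apply derivable_continuous_pt.
  exists (f' x); apply is_derive_Reals, Hf.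
- exists x0.
  apply (second_derivative_nonpos_at_local_max f f' x0 T); auto.
  intros x Hx; apply Rabs_def2 in Hx.
  destruct (Rlt_or_le x 0) as [Hn|Hn].
  + rewrite <- Hper; apply Hmax; lra.
  + destruct (Rle_or_lt x T) as [Hp|Hp]; [apply Hmax; lra|].
    replace x with (x - T + T) by ring.
    rewrite Hper; apply Hmax; lra.
Qed.

Lemma nonvanishing_constant_sign (F : R -> R) :
  (forall t, continuous F t) -> (forall t, F t <> 0) ->
  (forall t, 0 < F t) \/ (forall t, F t < 0).
Proof.
intros Hc Hn.
assert (Hs : forall a b, 0 < F a -> F b < 0 -> False).
{ intros a b Ha Hb.
  destruct (IVT_gen F a b 0) as [x [_ Hx]].
  - intros x; apply continuity_pt_filterlim, Hc.
  - rewrite Rmin_right, Rmax_left; lra.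
  - exact (Hn x Hx). }
destruct (Rdichotomy _ _ (Hn 0)) as [H|H]; [right|left]; intros t;
  destruct (Rdichotomy _ _ (Hn t)) as [H'|H']; try lra;
  exfalso; eauto.
Qed.

(** * Calculus of functions of two variables on an open set *)

Definition Cn_on (n : nat) (O : R * R -> Prop) (f : R -> R -> R) : Prop :=
  forall x y, O (x, y) -> ex_diff_n f n x y.

Lemma Cn_on_D1 (n : nat) (O : R * R -> Prop) (f : R -> R -> R) :
  Cn_on (S n) O f -> Cn_on n O (D1 f).
Proof. intros H x y Hxy; apply (ex_diff_n_deriv_aux1 f n x y (H x y Hxy)). Qed.

Lemma Cn_on_D2 (n : nat) (O : R * R -> Prop) (f : R -> R -> R) :
  Cn_on (S n) O f -> Cn_on n O (D2 f).
Proof. intros H x y Hxy; apply (ex_diff_n_deriv_aux2 f n x y (H x y Hxy)). Qed.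

Lemma is_derive_D1 (n : nat) (O : R * R -> Prop) (f : R -> R -> R) (x y : R) :
  Cn_on (S n) O f -> O (x, y) -> is_derive (fun s => f s y) x (D1 f x y).
Proof.
intros Hf Hxy; destruct (Hf x y Hxy) as [_ [H _]].
apply Derive_correct, H.
Qed.

Lemma is_derive_D2 (n : nat) (O : R * R -> Prop) (f : R -> R -> R) (x y : R) :
  Cn_on (S n) O f -> O (x, y) -> is_derive (fun t => f x t) y (D2 f x y).
Proof.
intros Hf Hxy; destruct (Hf x y Hxy) as [_ [_ [H _]]].
apply Derive_correct, H.
Qed.

(** Continuity of the first partial derivatives near the point gives Frechet
    differentiability, which the mere existence of partials would not. *)
Lemma chain_rule (O : R * R -> Prop) (f : R -> R -> R) (X Y : R -> R)
    (t X' Y' : R) :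
  open O -> Cn_on 1 O f -> O (X t, Y t) ->
  is_derive X t X' -> is_derive Y t Y' ->
  is_derive (fun s => f (X s) (Y s)) t
    (D1 f (X t) (Y t) * X' + D2 f (X t) (Y t) * Y').
Proof.
intros HO Hf Ht HX HY.
apply is_derive_Reals.
apply derivable_pt_lim_comp_2d; try (apply is_derive_Reals; assumption).
apply filterdiff_differentiable_pt_lim.
apply (is_derive_filterdiff f _ _ (D1 f)).
- generalize (HO _ Ht); apply filter_imp.
  intros [x y] Hxy; apply (is_derive_D1 0 O); assumption.
- apply (is_derive_D2 0 O); assumption.
- apply continuity_2d_pt_filterlim.
  apply (Cn_on_D1 0 O f Hf _ _ Ht).
Qed.

Lemma continuous_along_curve (O : R * R -> Prop) (f : R -> R -> R)
    (X Y : R -> R) (t : R) :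
  Cn_on 0 O f -> O (X t, Y t) -> continuous X t -> continuous Y t ->
  continuous (fun s => f (X s) (Y s)) t.
Proof.
intros Hf Ht HX HY.
apply (continuous_comp_2 X Y f); auto.
apply continuity_2d_pt_filterlim, (Hf _ _ Ht).
Qed.

(** * Curvature of the level curves in terms of the mean curvature *)

Lemma enorm_sqr (p q : R) : enorm (p, q) ^ 2 = p ^ 2 + q ^ 2.
Proof. unfold enorm; simpl fst; simpl snd; apply pow2_sqrt; nra. Qed.

Lemma sum_sqr_pos (p q : R) : (p, q) <> (0, 0) -> 0 < p ^ 2 + q ^ 2.
Proof.
intros Hpq; destruct (Req_dec p 0) as [->|Hp]; [destruct (Req_dec q 0) as [->|Hq]|].
- exfalso; apply Hpq; reflexivity.
- generalize (pow2_gt_0 q Hq); lra.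
- generalize (pow2_gt_0 p Hp) (pow2_ge_0 q); lra.
Qed.

(** [sigma = -1] is the Lorentzian, [sigma = 1] the Euclidean normalisation. *)
Lemma div_normalized_grad (O : R * R -> Prop) (u : R -> R -> R) (sigma x y : R) :
  Cn_on 2 O u -> O (x, y) ->
  let p := D1 u x y in let q := D2 u x y in
  let w := sqrt (1 + sigma * (p ^ 2 + q ^ 2)) in
  let A := D1 (D1 u) x y in let B := D2 (D2 u) x y in
  let m := D2 (D1 u) x y + D1 (D2 u) x y in
  0 < 1 + sigma * (p ^ 2 + q ^ 2) ->
  div (fun s t => vdiv (grad u s t)
        (sqrt (1 + sigma * enorm (grad u s t) ^ 2))) x y
  = (A + B) / w - sigma * (A * p ^ 2 + m * p * q + B * q ^ 2) / w ^ 3.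
Proof.
intros Hu Hxy p q w A B m Hpos.
assert (Hw : 0 < w) by (apply sqrt_lt_R0; exact Hpos).
assert (Hw2 : w * w = 1 + sigma * (p ^ 2 + q ^ 2)) by (apply sqrt_sqrt; lra).
assert (H11 := is_derive_D1 0 O _ x y (Cn_on_D1 1 O u Hu) Hxy).
assert (H12 := is_derive_D2 0 O _ x y (Cn_on_D1 1 O u Hu) Hxy).
assert (H21 := is_derive_D1 0 O _ x y (Cn_on_D2 1 O u Hu) Hxy).
assert (H22 := is_derive_D2 0 O _ x y (Cn_on_D2 1 O u Hu) Hxy).
assert (Hquot : forall (a b : R -> R) (z a' b' : R),
  a z ^ 2 + b z ^ 2 = p ^ 2 + q ^ 2 ->
  is_derive a z a' -> is_derive b z b' ->
  Derive (fun s => a s / sqrt (1 + sigma * (a s ^ 2 + b s ^ 2))) z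
  = a' / w - sigma * a z * (a z * a' + b z * b') / w ^ 3).
{ intros a b z a' b' Hz Ha Hb.
  apply is_derive_unique.
  assert (Hr : is_derive (fun s => 1 + sigma * (a s ^ 2 + b s ^ 2)) z
                 (sigma * (2 * (a z * a' + b z * b')))).
  { auto_derive.
    - repeat split; auto; eexists; eassumption.
    - rewrite (is_derive_unique (fun s : R => a s) _ _ Ha),
        (is_derive_unique (fun s : R => b s) _ _ Hb); ring. }
  assert (Hs : is_derive (fun s => sqrt (1 + sigma * (a s ^ 2 + b s ^ 2))) z
     (sigma * (2 * (a z * a' + b z * b'))
       / (2 * sqrt (1 + sigma * (a z ^ 2 + b z ^ 2))))).
  { apply (is_derive_sqrt (fun s => 1 + sigma * (a s ^ 2 + b s ^ 2)));
      [exact Hr|rewrite Hz; exact Hpos]. }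
  rewrite Hz in Hs; fold w in Hs.
  evar_last.
  - apply is_derive_div; [exact Ha|exact Hs|].
    cbv beta; rewrite Hz; fold w; lra.
  - cbv beta; rewrite Hz; fold w; field; lra. }
transitivity
  (Derive (fun s => D1 u s y / sqrt (1 + sigma * (D1 u s y ^ 2 + D2 u s y ^ 2))) x
   + Derive (fun t => D2 u x t / sqrt (1 + sigma * (D2 u x t ^ 2 + D1 u x t ^ 2)))
       y).
{ unfold div; f_equal; apply Derive_ext; intros t; unfold vdiv, grad;
    rewrite enorm_sqr; cbn [fst snd]; [reflexivity|].
  rewrite (Rplus_comm (D1 u x t ^ 2)); reflexivity. }
rewrite (Hquot (fun s => D1 u s y) (fun s => D2 u s y) x _ _ eq_refl H11 H21).
rewrite (Hquot (fun t => D2 u x t) (fun t => D1 u x t) y _ _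
           (Rplus_comm _ _) H22 H12).
fold p q A B; unfold m; field; lra.
Qed.

(** With [v^2 = p^2 + q^2], [L] the trace and [Q] the value at [(p, q)] of the
    Hessian form, the left-hand form equals [F = L v^2 - Q].  The constraints
    amount to [w^2 + W^2 = 2] and two linear equations for [L] and [Q], whose
    solution satisfies [F (w + W) = 2 H v^2 (2 + w W)]; squaring and
    [(2 + w W)^2 >= 4 (1 + w W)] give the bound.  In the application [m]
    is the sum of the two mixed second derivatives. *)
Lemma level_curvature_algebra (p q A B m H w W : R) :
  0 < w -> 0 < W ->
  w ^ 2 = 1 - (p ^ 2 + q ^ 2) -> W ^ 2 = 1 + (p ^ 2 + q ^ 2) ->
  2 * H = (A + B) / w + (A * p ^ 2 + m * p * q + B * q ^ 2) / w ^ 3 ->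
  2 * H = (A + B) / W - (A * p ^ 2 + m * p * q + B * q ^ 2) / W ^ 3 ->
  8 * H ^ 2 * (p ^ 2 + q ^ 2) ^ 2 <= (A * q ^ 2 - m * p * q + B * p ^ 2) ^ 2.
Proof.
intros Hw HW Hw2 HW2 H1 H2.
replace (A * q ^ 2 - m * p * q + B * p ^ 2) with
  ((A + B) * (p ^ 2 + q ^ 2) - (A * p ^ 2 + m * p * q + B * q ^ 2)) by ring.
set (Q := A * p ^ 2 + m * p * q + B * q ^ 2) in *.
set (L := A + B) in *.
set (v2 := p ^ 2 + q ^ 2) in *.
assert (E1 : 2 * H * w ^ 3 = L * w ^ 2 + Q) by (rewrite H1; field; lra).
assert (E2 : 2 * H * W ^ 3 = L * W ^ 2 - Q) by (rewrite H2; field; lra).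
assert (E : (L * v2 - Q) * (w + W) = 2 * H * v2 * (2 + w * W)).
{ assert (EL : L = H * (w ^ 3 + W ^ 3)).
  { apply Rmult_eq_reg_l with 2; [|lra].
    transitivity (L * w ^ 2 + Q + (L * W ^ 2 - Q)); [rewrite Hw2, HW2|]; lra. }
  replace (L * v2 - Q) with (H * (W ^ 3 - w ^ 3)).
  2:{ transitivity (L * (w ^ 2 + v2) - 2 * H * w ^ 3);
        [rewrite Hw2, EL|rewrite E1]; ring. }
  transitivity (H * (W ^ 2 - w ^ 2) * (w ^ 2 + W ^ 2 + w * W)); [ring|].
  rewrite Hw2, HW2; ring. }
assert (Hz : 0 < w * W) by (apply Rmult_lt_0_compat; assumption).
set (z := w * W) in *.
assert (Es : (w + W) ^ 2 = 2 * (1 + z)) by (unfold z; nra).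
assert (E3 : (L * v2 - Q) ^ 2 * (2 * (1 + z)) = 4 * (H * v2) ^ 2 * (2 + z) ^ 2).
{ rewrite <- Es, <- Rpow_mult_distr, E; ring. }
apply Rmult_le_reg_r with (2 * (1 + z)); [lra|].
rewrite E3.
replace (8 * H ^ 2 * v2 ^ 2 * (2 * (1 + z)))
  with (4 * (H * v2) ^ 2 * (4 * (1 + z))) by ring.
apply Rmult_le_compat_l; [|nra].
generalize (pow2_ge_0 (H * v2)); lra.
Qed.

(** Divided by [|Du|^6], this reads [kappa^2 >= 8 H^2] for the curvature [kappa]
    of the level curve.  The exponent 3 on the left weakens, by [|Du| < 1], the
    exponent 2 of the algebraic inequality. *)
Lemma level_curvature_bound (O : R * R -> Prop) (u : R -> R -> R) (x y : R) :
  Cn_on 2 O u -> O (x, y) -> enorm (grad u x y) < 1 ->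
  H_R u x y = H_L u x y ->
  let p := D1 u x y in let q := D2 u x y in
  let A := D1 (D1 u) x y in let B := D2 (D2 u) x y in
  let m := D2 (D1 u) x y + D1 (D2 u) x y in
  8 * H_L u x y ^ 2 * (p ^ 2 + q ^ 2) ^ 3
    <= (A * q ^ 2 - m * p * q + B * p ^ 2) ^ 2.
Proof.
intros Hu Hxy Hsp HRL p q A B m.
assert (Hv1 : p ^ 2 + q ^ 2 < 1).
{ rewrite <- enorm_sqr; change (p, q) with (grad u x y).
  assert (0 <= enorm (grad u x y)) by apply sqrt_pos.
  nra. }
assert (Hv0 : 0 <= p ^ 2 + q ^ 2)
  by (apply Rplus_le_le_0_compat; apply pow2_ge_0).
assert (HL := div_normalized_grad O u (-1) x y Hu Hxy).
assert (HR := div_normalized_grad O u 1 x y Hu Hxy).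
cbv zeta in HL, HR; fold p q A B m in HL, HR.
specialize (HL ltac:(lra)); specialize (HR ltac:(lra)).
assert (EL : H_L u x y = / 2 * div (fun s t => vdiv (grad u s t)
               (sqrt (1 + -1 * enorm (grad u s t) ^ 2))) x y).
{ unfold H_L, div; f_equal; f_equal; apply Derive_ext; intros t; cbv beta;
    do 3 f_equal; ring. }
assert (ER : H_R u x y = / 2 * div (fun s t => vdiv (grad u s t)
               (sqrt (1 + 1 * enorm (grad u s t) ^ 2))) x y).
{ unfold H_R, div; f_equal; f_equal; apply Derive_ext; intros t; cbv beta;
    do 3 f_equal; ring. }
rewrite HL in EL; rewrite HR in ER.
apply Rle_trans with (8 * H_L u x y ^ 2 * (p ^ 2 + q ^ 2) ^ 2).
{ apply Rmult_le_compat_l; [generalize (pow2_ge_0 (H_L u x y)); lra|].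
  generalize (pow2_ge_0 (p ^ 2 + q ^ 2)); nra. }
apply level_curvature_algebra with
  (w := sqrt (1 + -1 * (p ^ 2 + q ^ 2))) (W := sqrt (1 + 1 * (p ^ 2 + q ^ 2))).
- apply sqrt_lt_R0; lra.
- apply sqrt_lt_R0; lra.
- rewrite pow2_sqrt; lra.
- rewrite pow2_sqrt; lra.
- rewrite EL; unfold Rdiv; lra.
- rewrite <- HRL, ER; unfold Rdiv; lra.
Qed.

(** * Comparison of a level curve with a circle *)

Lemma circle_second_order (O : R * R -> Prop) (u : R -> R -> R) (c1 c2 r t : R) :
  open O -> Cn_on 2 O u ->
  (forall t, O (c1 + r * cos t, c2 + r * sin t)) ->
  let on g t := g (c1 + r * cos t) (c2 + r * sin t) in
  let f' t := r * (on (D2 u) t * cos t - on (D1 u) t * sin t) in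
  is_derive (on u) t (f' t) /\
  is_derive f' t
    (r ^ 2 * (on (D1 (D1 u)) t * sin t ^ 2
       - (on (D2 (D1 u)) t + on (D1 (D2 u)) t) * cos t * sin t
       + on (D2 (D2 u)) t * cos t ^ 2)
     - r * (on (D1 u) t * cos t + on (D2 u) t * sin t)).
Proof.
intros HO Hu Hcirc on f'.
assert (HX : is_derive (fun t => c1 + r * cos t) t (- (r * sin t))).
{ auto_derive; [trivial|ring]. }
assert (HY : is_derive (fun t => c2 + r * sin t) t (r * cos t)).
{ auto_derive; [trivial|ring]. }
assert (H0 := chain_rule O u _ _ t _ _ HO
  (fun x y H => ex_diff_n_m 2 1 ltac:(auto) u x y (Hu x y H)) (Hcirc t) HX HY).
assert (H1 := chain_rule O _ _ _ t _ _ HO (Cn_on_D1 1 O u Hu) (Hcirc t) HX HY).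
assert (H2 := chain_rule O _ _ _ t _ _ HO (Cn_on_D2 1 O u Hu) (Hcirc t) HX HY).
split.
- evar_last; [exact H0|unfold f', on; ring].
- unfold f', on.
  set (a := fun s => D1 u (c1 + r * cos s) (c2 + r * sin s)) in *.
  set (b := fun s => D2 u (c1 + r * cos s) (c2 + r * sin s)) in *.
  apply is_derive_ext with (fun s => r * (b s * cos s - a s * sin s)).
  { reflexivity. }
  auto_derive.
  + repeat split; eexists; eassumption.
  + rewrite (is_derive_unique (fun s : R => a s) _ _ H1),
      (is_derive_unique (fun s : R => b s) _ _ H2).
    unfold a, b; ring.
Qed.

(** The second-order condition at a critical point [t] of [u] along the circle
    reads [r^2 T - r g <= 0] at a maximum and [>= 0] at a minimum, where [T] is
    the second derivative of [u] in the tangential and [g] the first derivative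
    in the radial direction.  There [Du] is radial, so [F = g^2 T], and [T] has
    the sign of [F].  Choosing the maximum for [F > 0] and the minimum for
    [F < 0], the condition forces [g] to have that sign too and gives
    [r |T| <= |g|], whereas the hypothesis on the curvature says
    [8 h^2 g^2 <= T^2]. *)
Lemma curvature_radius_bound (O : R * R -> Prop) (u : R -> R -> R)
    (c1 c2 r h : R) :
  open O -> Cn_on 2 O u -> 0 < r -> 0 < h ->
  (forall t, O (c1 + r * cos t, c2 + r * sin t)) ->
  (forall t, let x := c1 + r * cos t in let y := c2 + r * sin t in
    grad u x y <> (0, 0) /\
    8 * h ^ 2 * (D1 u x y ^ 2 + D2 u x y ^ 2) ^ 3 <=
    (D1 (D1 u) x y * D2 u x y ^ 2
     - (D2 (D1 u) x y + D1 (D2 u) x y) * D1 u x y * D2 u x y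
     + D2 (D2 u) x y * D1 u x y ^ 2) ^ 2) ->
  8 * h ^ 2 * r ^ 2 <= 1.
Proof.
intros HO Hu Hr Hh Hcirc Hcurv.
pose (X t := c1 + r * cos t); pose (Y t := c2 + r * sin t).
pose (p t := D1 u (X t) (Y t)); pose (q t := D2 u (X t) (Y t)).
pose (A t := D1 (D1 u) (X t) (Y t)); pose (B t := D2 (D2 u) (X t) (Y t)).
pose (m t := D2 (D1 u) (X t) (Y t) + D1 (D2 u) (X t) (Y t)).
pose (F t := A t * q t ^ 2 - m t * p t * q t + B t * p t ^ 2).
pose (T t := A t * sin t ^ 2 - m t * cos t * sin t + B t * cos t ^ 2).
pose (g t := p t * cos t + q t * sin t).
assert (Hv : forall t, 0 < p t ^ 2 + q t ^ 2).
{ intros t; apply sum_sqr_pos, (Hcurv t). }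
assert (HF : forall t, 8 * h ^ 2 * (p t ^ 2 + q t ^ 2) ^ 3 <= F t ^ 2).
{ intros t; apply (Hcurv t). }
assert (HF0 : forall t, F t <> 0).
{ intros t Ht; specialize (HF t); rewrite Ht in HF.
  assert (0 < h ^ 2 * (p t ^ 2 + q t ^ 2) ^ 3).
  { apply Rmult_lt_0_compat; apply pow_lt; auto. }
  lra. }
assert (HFc : forall t, continuous F t).
{ assert (Hc : forall f t, Cn_on 0 O f -> continuity_pt (fun s => f (X s) (Y s)) t).
  { intros f t Hf; apply continuity_pt_filterlim.
    apply (continuous_along_curve O); auto.
    - apply Hcirc.
    - apply (ex_derive_continuous (V := R_NormedModule) X).
      unfold X; auto_derive; trivial.
    - apply (ex_derive_continuous (V := R_NormedModule) Y).
      unfold Y; auto_derive; trivial. }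
  intros t; apply continuity_pt_filterlim.
  assert (C0 : forall f, Cn_on 1 O f -> Cn_on 0 O f).
  { intros f Hf x y Hxy; apply ex_diff_n_m with 1%nat; auto. }
  assert (continuity_pt p t) by (apply Hc, C0, Cn_on_D1, Hu).
  assert (continuity_pt q t) by (apply Hc, C0, Cn_on_D2, Hu).
  assert (continuity_pt A t) by (apply Hc, Cn_on_D1, Cn_on_D1, Hu).
  assert (continuity_pt B t) by (apply Hc, Cn_on_D2, Cn_on_D2, Hu).
  assert (continuity_pt m t).
  { apply (continuity_pt_plus (fun s => D2 (D1 u) (X s) (Y s))
             (fun s => D1 (D2 u) (X s) (Y s))).
    - apply Hc, Cn_on_D2, Cn_on_D1, Hu.
    - apply Hc, Cn_on_D1, Cn_on_D2, Hu. }
  apply continuity_pt_ext with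
    (f := ((A * (q * q) - m * p * q) + B * (p * p))%F).
  { intros s; unfold F, plus_fct, minus_fct, mult_fct; ring. }
  apply continuity_pt_plus; [apply continuity_pt_minus|];
    repeat apply continuity_pt_mult; assumption. }
(* at a critical point of u on the circle, Du = g (cos, sin) *)
assert (Hcrit : forall t, r * (q t * cos t - p t * sin t) = 0 ->
  8 * h ^ 2 * g t ^ 2 <= T t ^ 2 /\ F t = g t ^ 2 * T t).
{ intros t H0.
  assert (H0' : q t * cos t = p t * sin t) by nra.
  assert (Hcs : sin t ^ 2 + cos t ^ 2 = 1).
  { generalize (sin2_cos2 t); unfold Rsqr; nra. }
  assert (Hp : p t = g t * cos t).
  { transitivity (p t * (sin t ^ 2 + cos t ^ 2)); [rewrite Hcs; ring|].
    unfold g; transitivity (p t * cos t ^ 2 + (p t * sin t) * sin t); [ring|].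
    rewrite <- H0'; ring. }
  assert (Hq : q t = g t * sin t).
  { transitivity (q t * (sin t ^ 2 + cos t ^ 2)); [rewrite Hcs; ring|].
    unfold g; transitivity (q t * sin t ^ 2 + (q t * cos t) * cos t); [ring|].
    rewrite H0'; ring. }
  assert (Hvg : p t ^ 2 + q t ^ 2 = g t ^ 2).
  { rewrite Hp, Hq; transitivity (g t ^ 2 * (sin t ^ 2 + cos t ^ 2)); [ring|].
    rewrite Hcs; ring. }
  assert (HFT : F t = g t ^ 2 * T t).
  { unfold F, T; rewrite Hp, Hq; ring. }
  split; [|exact HFT].
  specialize (HF t); specialize (Hv t).
  rewrite HFT, Hvg in HF; rewrite Hvg in Hv.
  apply Rmult_le_reg_l with ((g t ^ 2) ^ 2); [apply pow_lt, Hv|].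
  replace ((g t ^ 2) ^ 2 * T t ^ 2) with ((g t ^ 2 * T t) ^ 2) by ring.
  lra. }
assert (Hper : forall s, u (X (s + 2 * PI)) (Y (s + 2 * PI)) = u (X s) (Y s)).
{ intros s; unfold X, Y; rewrite cos_plus, sin_plus, cos_2PI, sin_2PI.
  f_equal; ring. }
assert (HPI : 0 < 2 * PI) by (generalize PI_RGT_0; lra).
assert (Hd := fun t => circle_second_order O u c1 c2 r t HO Hu Hcirc).
cbv zeta in Hd; fold (X) (Y) in Hd.
pose (f' t := r * (q t * cos t - p t * sin t)).
pose (f'' t := r ^ 2 * T t - r * g t).
assert (Hd1 : forall t, is_derive (fun s => u (X s) (Y s)) t (f' t)).
{ intros t; apply (Hd t). }
assert (Hd2 : forall t, is_derive f' t (f'' t)).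
{ intros t; apply (Hd t). }
assert (Hconcl : forall a b, 0 < a -> r ^ 2 * a <= r * b ->
  8 * h ^ 2 * b ^ 2 <= a ^ 2 -> 8 * h ^ 2 * r ^ 2 <= 1).
{ intros a b Ha Hab Hb.
  assert (Hab' : r * a <= b) by nra.
  assert (0 < r * a) by (apply Rmult_lt_0_compat; assumption).
  apply Rmult_le_reg_l with (b ^ 2); [apply pow_lt; lra|].
  assert ((r * a) ^ 2 <= b ^ 2) by (apply pow_incr; lra).
  assert (r ^ 2 * (8 * h ^ 2 * b ^ 2) <= r ^ 2 * a ^ 2).
  { apply Rmult_le_compat_l; [apply pow2_ge_0|exact Hb]. }
  lra. }
destruct (nonvanishing_constant_sign F HFc HF0) as [Hs|Hs].
- destruct (periodic_max_second_order _ f' f'' _ HPI Hper Hd1 Hd2)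
    as [t [H1 H2]].
  destruct (Hcrit t H1) as [H3 H4]; specialize (Hs t).
  unfold f'' in H2; apply (Hconcl (T t) (g t)); try lra.
  rewrite H4 in Hs; generalize (pow2_ge_0 (g t)); nra.
- destruct (periodic_max_second_order (fun s => - u (X s) (Y s))
      (fun t => - f' t) (fun t => - f'' t) (2 * PI) HPI)
    as [t [H1 H2]].
  + intros s; rewrite Hper; reflexivity.
  + intros s; apply (is_derive_opp _ _ _ (Hd1 s)).
  + intros s; apply (is_derive_opp _ _ _ (Hd2 s)).
  + assert (H1' : f' t = 0) by lra.
    destruct (Hcrit t H1') as [H3 H4]; specialize (Hs t).
    unfold f'' in H2; apply (Hconcl (- T t) (- g t)); try lra.
    rewrite H4 in Hs; generalize (pow2_ge_0 (g t)); nra.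
Qed.

(** * Discs of noncritical points *)

Lemma disc_radius_bound (Omega : R * R -> Prop) (u : R -> R -> R)
    (c : R * R) (r h : R) :
  open Omega -> Cn_on 2 Omega u ->
  (forall x y, Omega (x, y) -> enorm (grad u x y) < 1) ->
  (forall x y, Omega (x, y) -> H_R u x y = H_L u x y) ->
  0 < r -> 0 < h ->
  (forall p, closed_disc c r p -> noncritical Omega u p) ->
  (forall x y, noncritical Omega u (x, y) -> h <= Rabs (H_L u x y)) ->
  2 * r <= / (sqrt 2 * h).
Proof.
intros HO Hu Hsp HRL Hr Hh Hdisc Hinf.
assert (Hcirc : forall t,
  noncritical Omega u (fst c + r * cos t, snd c + r * sin t)).
{ intros t; apply Hdisc; unfold closed_disc, enorm; simpl fst; simpl snd.
  replace (_ + _) with (r ^ 2).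
  - rewrite sqrt_pow2; lra.
  - transitivity (r ^ 2 * ((sin t)² + (cos t)²)).
    + rewrite sin2_cos2; ring.
    + unfold Rsqr; ring. }
assert (Hb : 8 * h ^ 2 * r ^ 2 <= 1).
{ apply (curvature_radius_bound Omega u (fst c) (snd c) r h); auto.
  - intros t; apply Hcirc.
  - intros t x y; destruct (Hcirc t) as [Hin Hnc].
    split; [exact Hnc|].
    eapply Rle_trans; [|apply (level_curvature_bound Omega u x y); auto].
    apply Rmult_le_compat_r.
    { apply pow_le, Rplus_le_le_0_compat; apply pow2_ge_0. }
    apply Rmult_le_compat_l; [lra|].
    rewrite <- (pow2_abs (H_L u x y)).
    apply pow_incr; split; [lra|apply Hinf, Hcirc]. }
assert (Hs2 : 0 < sqrt 2) by (apply sqrt_lt_R0; lra).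
assert (Hss : sqrt 2 * sqrt 2 = 2) by (apply sqrt_sqrt; lra).
assert (Hsh : 0 < sqrt 2 * h) by (apply Rmult_lt_0_compat; assumption).
apply Rmult_le_reg_r with (sqrt 2 * h); [exact Hsh|].
rewrite Rinv_l by lra.
apply Rsqr_incr_0_var; [|lra].
unfold Rsqr; nra.
Qed.

Theorem theorem8 (Omega : R * R -> Prop) (u : R -> R -> R)
  (HOmega : is_domain Omega)
  (Hu : smooth_on Omega u)
  (Hspacelike : forall x y : R, Omega (x, y) -> enorm (grad u x y) < 1)
  (HRL : forall x y : R, Omega (x, y) -> H_R u x y = H_L u x y) :
  Rbar_le (width (noncritical Omega u))
    (recip (Rbar_mult (Finite (sqrt 2)) (inf_abs_on (noncritical Omega u) (H_L u)))).
Proof.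
assert (Hs2 : 0 < sqrt 2) by (apply sqrt_lt_R0; lra).
assert (Hglb := Glb_Rbar_correct (fun h => exists x y : R,
  noncritical Omega u (x, y) /\ h = Rabs (H_L u x y))).
unfold inf_abs_on; set (inf := Glb_Rbar _) in *.
destruct Hglb as [Hlb Hgreatest].
assert (Hinf0 : Rbar_le 0 inf).
{ apply Hgreatest; intros h [x [y [_ ->]]]; apply Rabs_pos. }
apply Lub_Rbar_correct; intros d Hd.
destruct inf as [h| |].
- simpl in Hinf0 |- *.
  destruct (Req_EM_T (sqrt 2 * h) 0) as [E|E]; [exact I|].
  assert (Hh : 0 < h) by (destruct Hinf0 as [|<-]; [assumption|exfalso; lra]).
  simpl.
  destruct Hd as [->|[c [r [Hr [Hdisc ->]]]]].
  + apply Rlt_le, Rinv_0_lt_compat, Rmult_lt_0_compat; assumption.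
  + apply (disc_radius_bound Omega u c r h); auto.
    * apply HOmega.
    * exact (Hu 2%nat).
    * intros x y Hxy; apply (Hlb (Rabs (H_L u x y))); eauto.
- (* infinite infimum: there is no noncritical point, hence no disc *)
  destruct Hd as [->|[c [r [Hr [Hdisc ->]]]]].
  + replace (Rbar_mult (sqrt 2) p_infty) with p_infty; [apply Rle_refl|].
    symmetry; apply is_Rbar_mult_unique.
    apply is_Rbar_mult_sym, is_Rbar_mult_p_infty_pos; exact Hs2.
  + exfalso.
    apply (Hlb (Rabs (H_L u (fst c) (snd c)))).
    exists (fst c), (snd c); split; [|reflexivity].
    apply Hdisc; unfold closed_disc, enorm; simpl fst; simpl snd.
    rewrite !Rminus_diag; simpl.
    rewrite !Rmult_0_l, Rplus_0_l, sqrt_0; lra.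
- destruct Hinf0.
Qed.
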